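(* Let $\mathfrak C$ be a left cancellative small category. The following are equivalent: (i) $I_l\ltimes\Omega$ is topologically free; (ii) $\mathfrak C^{*,0}\ltimes\Omega$ is topologically free; (iii) For all $\mathfrak v\in\mathfrak C^0$, $u\in\mathfrak v\mathfrak C^*\mathfrak v$ and $f_1,\dots,f_n\in\mathcal J$ with $f_i\subsetneq\mathfrak v\mathfrak C$ for all $1\le i\le n$: if $uz\in z\mathfrak C^*$ for all $z\in\mathfrak v\mathfrak C\setminus\bigcup_{i=1}^nf_i$, then there exists $x\in\mathfrak v\mathfrak C\setminus\bigcup_{i=1}^nf_i$ with $ux=x$.
   Context: $\mathfrak C$ denotes the set of morphisms, $\mathfrak C^0\subseteq\mathfrak C$ the identity morphisms (identified with objects), $\mathfrak d,\mathfrak t$ domain and target; $cd$ is defined iff $\mathfrak d(c)=\mathfrak t(d)$; left cancellative means $cx=cy\Rightarrow x=y$. For $S\subseteq\mathfrak C$, $cS=\{cs:s\in S,\mathfrak t(s)=\mathfrak d(c)\}$. $\mathfrak C^*$ is the set of invertible elements, $\mathfrak v\mathfrak C^*\mathfrak v$ the set of $u\in\mathfrak C^*$ with $\mathfrak t(u)=\mathfrak d(u)=\mathfrak v$, and $\mathfrak C^{*,0}=\{u\in\mathfrak C^*:\mathfrak t(u)=\mathfrak d(u)\}$. Each $c\in\mathfrak C$ gives the partial bijection $\mathfrak d(c)\mathfrak C\to c\mathfrak C$, $x\mapsto cx$, again denoted $c$; $I_l$ is the smallest semigroup of partial bijections of $\mathfrak C$ containing these and closed under inverses; $\mathcal J=\{\mathrm{dom}(s):s\in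 I_l\}$ is its semilattice of idempotents (product = intersection, order = inclusion). $\widehat{\mathcal J}$ is the space of non-zero multiplicative maps $\chi:\mathcal J\to\{0,1\}$ with $\chi(\emptyset)=0$ if $\emptyset\in\mathcal J$ (pointwise convergence). $\Omega\subseteq\widehat{\mathcal J}$ consists of those $\chi$ such that whenever $e=\bigcup_{i=1}^nf_i$ ($e,f_i\in\mathcal J$) and $\chi(e)=1$, then $\chi(f_i)=1$ for some $i$. $s\in I_l$ acts by $\chi\mapsto s.\chi=\chi(s^{-1}\cdot s)$ from $\Omega(s^{-1}s)=\{\chi\in\Omega:\chi(s^{-1}s)=1\}$ onto $\Omega(ss^{-1})$. $I_l\ltimes\Omega$ is the transformation groupoid: classes $[s,\chi]$ with $s\in I_l$, $\chi\in\Omega(s^{-1}s)$, where $[s,\chi]=[t,\psi]$ iff $\chi=\psi$ and $se=te$ for some $e\in\mathcal J$ with $\chi(e)=1$; source $\chi$, range $s.\chi$, $[s,t.\chi][t,\chi]=[st,\chi]$; topology such that the sets $\{[s,\chi]:\chi\in\Omega(s^{-1}s)\}$ are open and the source map restricts to homeomorphisms from them onto $\Omega(s^{-1}s)$. $\mathfrak C^{*,0}\ltimes\Omega:=\{[u,\chi]\in I_l\ltimes\Omega:u\in\mathfrak C^{*,0}\}$, an open subgroupoid. An étale groupoid $\mathcal G$ (not necessarily Hausdorff) is topologically free if for every open bisection $\gamma\subseteq\mathcal G\setminus\mathcal G^{(0)}$, the set $\{x\in\mathcal G^{(0)}:\mathcal G^x_x\cap\gamma\ne\emptyset\}$ has empty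 interior. *)

(* Defs.v *)
From HB Require Import structures.
From mathcomp Require Import all_boot.
From mathcomp Require Import all_classical.
From mathcomp Require Import topology.

Set Implicit Arguments.
Unset Strict Implicit.
Unset Printing Implicit Defensive.

Local Open Scope classical_set_scope.
Local Open Scope quotient_scope.

(* A small category given by its set of morphisms; the identity morphism
   [cidm v] stands for the object [v]. The product [cmul c d] ("first d, then
   c") is only meaningful when [cdom c = ctgt d]: no axiom constrains it
   otherwise, and every use below is guarded by that equation. *)
Record small_category := SmallCategory {
  cobj : Type;
  cmor :> Type;
  cdom : cmor -> cobj;
  ctgt : cmor -> cobj;
  cidm : cobj -> cmor;
  cmul : cmor -> cmor -> cmor;
  cdom_id : forall v, cdom (cidm v) = v;
  ctgt_id : forall v, ctgt (cidm v) = v;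
  cdom_mul : forall c d, cdom c = ctgt d -> cdom (cmul c d) = cdom d;
  ctgt_mul : forall c d, cdom c = ctgt d -> ctgt (cmul c d) = ctgt c;
  cmul1l : forall c, cmul (cidm (ctgt c)) c = c;
  cmul1r : forall c, cmul c (cidm (cdom c)) = c;
  cmulA : forall b c d, cdom b = ctgt c -> cdom c = ctgt d ->
    cmul b (cmul c d) = cmul (cmul b c) d
}.

Record left_cancellative_category := LeftCancellativeCategory {
  lcat :> small_category;
  cmulI : forall c x y : lcat, cdom c = ctgt x -> cdom c = ctgt y ->
    cmul c x = cmul c y -> x = y
}.

Section Units.
Variable C : small_category.

(* c S *)
Definition lmul_set (c : C) (S : set C) : set C :=
  [set cmul c s | s in [set s | S s /\ ctgt s = cdom c]].

(* v C *)
Definition principal (v : cobj C) : set C := lmul_set (cidm v) setT.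

Definition invertible : set C :=
  [set u | exists u' : C, [/\ cdom u = ctgt u', cdom u' = ctgt u,
     cmul u u' = cidm (ctgt u) & cmul u' u = cidm (cdom u)]].

(* C^{*,0} *)
Definition loop_units : set C :=
  [set u | invertible u /\ ctgt u = cdom u].

(* v C^* v *)
Definition units_at (v : cobj C) : set C :=
  [set u | [/\ invertible u, ctgt u = v & cdom u = v]].

Lemma principalE v : principal v = [set x | ctgt x = v].
Proof.
apply/seteqP; split=> x /=.
  move=> [y /= [_ yv] <-]; rewrite cdom_id in yv.
  by rewrite ctgt_mul ?cdom_id ?ctgt_id.
by move=> xv; exists x; rewrite ?cdom_id //= -xv cmul1l.
Qed.

End Units.

(* [graph s x y] means that [s] is defined at [x] with value [y]. *)
Record partial_bij (T : Type) := PartialBij {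
  graph : T -> T -> Prop;
  graph_fun : forall x y y', graph x y -> graph x y' -> y = y';
  graph_inj : forall x x' y, graph x y -> graph x' y -> x = x'
}.

HB.instance Definition _ (T : Type) := gen_eqMixin (partial_bij T).
HB.instance Definition _ (T : Type) := gen_choiceMixin (partial_bij T).

Section PartialBij.
Variable T : Type.
Implicit Types s t : partial_bij T.

Lemma partial_bijP s t :
  (forall x y, graph s x y <-> graph t x y) -> s = t.
Proof.
case: s t => [g gf gi] [h hf hi] /= gh.
have e : g = h by apply/funext => x; apply/funext => y; apply/propext.
by subst h; rewrite (Prop_irrelevance gf hf) (Prop_irrelevance gi hi).
Qed.

Definition pdom s : set T := [set x | exists y, graph s x y].

(* [pcomp s t] is the product s t: first t, then s, where defined *)
Definition pcomp s t : partial_bij T.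
Proof.
refine (@PartialBij T (fun x z => exists2 y, graph t x y & graph s y z) _ _).
- move=> x y y' [z xz zy] [z' xz' zy'].
  by rewrite (graph_fun xz' xz) in zy'; exact: graph_fun zy zy'.
- move=> x x' y [z xz zy] [z' xz' zy'].
  by rewrite (graph_inj zy' zy) in xz'; exact: graph_inj xz xz'.
Defined.

Definition pinv s : partial_bij T :=
  @PartialBij T (fun x y => graph s y x)
    (fun x y y' => @graph_inj T s y y' x) (fun x x' y => @graph_fun T s y x x').

Definition pid (A : set T) : partial_bij T.
Proof.
refine (@PartialBij T (fun x y => A x /\ x = y) _ _).
- by move=> x y y' [_ <-] [_ <-].
- by move=> x x' y [_ ->] [_ ->].
Defined.

Lemma pinvK s : pinv (pinv s) = s.
Proof. exact: partial_bijP. Qed.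

Lemma pcompA r s t : pcomp r (pcomp s t) = pcomp (pcomp r s) t.
Proof.
apply: partial_bijP => x y; split.
- by move=> [z [w xw wz] zy]; exists w => //; exists z.
- by move=> [z xz [w zw wy]]; exists w => //; exists z.
Qed.

Lemma pid_pdom s : pid (pdom s) = pcomp (pinv s) s.
Proof.
apply: partial_bijP => x y; split.
- by move=> [[z xz] <-]; exists z.
- by move=> [z xz yz]; split; [exists z | exact: graph_inj xz yz].
Qed.

Lemma pdom_pid A : pdom (pid A) = A.
Proof. by apply/seteqP; split=> x; [move=> [y []] | move=> Ax; exists x]. Qed.

End PartialBij.

Section InverseSemigroup.
Variable C : left_cancellative_category.

(* the partial bijection d(c) C -> c C, x |-> c x *)
Definition lmul (c : C) : partial_bij C.
Proof.
refine (@PartialBij C (fun x y => principal (cdom c) x /\ y = cmul c x) _ _).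
- by move=> x y y' [_ ->] [_ ->].
- move=> x x' y; rewrite principalE => -[xc ->] [x'c]; exact: cmulI.
Defined.

Inductive Il : set (partial_bij C) :=
  | Il_lmul c : Il (lmul c)
  | Il_comp s t : Il s -> Il t -> Il (pcomp s t)
  | Il_inv s : Il s -> Il (pinv s).

Definition J : set (set C) := [set pdom s | s in Il].

Lemma J_pdom s : Il s -> J (pdom s).
Proof. by move=> sI; exists s. Qed.

Lemma Il_pid e : J e -> Il (pid e).
Proof.
move=> [s sI <-]; rewrite pid_pdom.
by apply: Il_comp => //; exact: Il_inv.
Qed.

Lemma J_setI e f : J e -> J f -> J (e `&` f).
Proof.
move=> /Il_pid eI /Il_pid fI; exists (pcomp (pid e) (pid f)).
  exact: Il_comp.
apply/seteqP; split=> x.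
  by move=> [y [z [fx <-] [ex _]]].
by move=> [ex fx]; exists x; exists x.
Qed.

Lemma J_sub_principal e : J e -> exists v, e `<=` principal v.
Proof.
move=> [s sI <-]; suff [v [w [sv _]]] :
  exists v w, pdom s `<=` principal v /\ pdom (pinv s) `<=` principal w.
  by exists v.
elim: sI => {s} [c | s t _ [v [w [sv sw]]] _ [v' [w' [tv tw]]] |
                 s _ [v [w [sv sw]]]].
- exists (cdom c), (ctgt c); split; first by move=> x [y [] ].
  move=> y [x []]; rewrite !principalE /= => xc ->.
  by rewrite ctgt_mul.
- exists v', w; split.
    by move=> x [y [z xz zy]]; apply: tv; exists z.
  by move=> y [x [z xz zy]]; apply: sw; exists z.
- by exists w, v; split; [|rewrite pinvK].
Qed.

Lemma J_principal v : J (principal v).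
Proof.
exists (lmul (cidm v)); first exact: Il_lmul.
apply/seteqP; split=> x; first by move=> [y []]; rewrite cdom_id.
by move=> vx; exists (cmul (cidm v) x); rewrite /= cdom_id.
Qed.

Definition il_mul (s t : Il) : Il :=
  exist _ (pcomp (\val s) (\val t))
    (mem_set (Il_comp (set_valP s) (set_valP t))).

Definition il_inv (s : Il) : Il :=
  exist _ (pinv (\val s)) (mem_set (Il_inv (set_valP s))).

Definition il_lmul (c : C) : Il := exist _ (lmul c) (mem_set (Il_lmul c)).

Definition il_id (e : J) : Il :=
  exist _ (pid (\val e)) (mem_set (Il_pid (set_valP e))).

Definition j_dom (s : Il) : J :=
  exist _ (pdom (\val s)) (mem_set (J_pdom (set_valP s))).

Definition j_meet (e f : J) : J :=
  exist _ (\val e `&` \val f) (mem_set (J_setI (set_valP e) (set_valP f))).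

Definition j_principal (v : cobj C) : J :=
  exist _ (principal v) (mem_set (J_principal v)).

(* the idempotent s^{-1} e s, idempotents being identified with their domains *)
Definition j_conj (s : Il) (e : J) : J :=
  j_dom (il_mul (il_inv s) (il_mul (il_id e) s)).

Lemma j_conjP s e x :
  \val (j_conj s e) x <-> exists2 y, graph (\val s) x y & \val e y.
Proof.
split; first by move=> [y [z [z' xz [ez _]] zy]]; exists z'.
by move=> [y xy ey]; exists x; exists y => //; exists y.
Qed.

(* Ĵ, as a subset of the space of all maps J -> {0,1} with the topology of
   pointwise convergence *)
Definition Jhat : set {ptws J -> bool} :=
  [set chi : J -> bool | [/\ exists e, chi e,
     forall e f, chi (j_meet e f) = chi e && chi f &
     forall e, \val e = set0 -> chi e = false]].

Definition Omega : set {ptws J -> bool} :=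
  [set chi : J -> bool | Jhat chi /\
     forall (e : J) (n : nat) (f : 'I_n -> J),
       \val e = \bigcup_i \val (f i) -> chi e -> exists i, chi (f i)].

Definition ev (chi : Omega) : J -> bool := \val chi.

Lemma omega_eq (chi psi : Omega) : (forall e, ev chi e = ev psi e) -> chi = psi.
Proof. by move=> h; apply/val_inj/funext. Qed.

Lemma ev_meet (chi : Omega) e f : ev chi (j_meet e f) = ev chi e && ev chi f.
Proof. by have [[_ + _] _] := set_valP chi; apply. Qed.

Lemma ev_empty (chi : Omega) e : \val e = set0 -> ev chi e = false.
Proof. by have [[_ _ +] _] := set_valP chi; apply. Qed.

Lemma ev_ex (chi : Omega) : exists e, ev chi e.
Proof. by have [[] ] := set_valP chi. Qed.

Lemma j_eq (e f : J) : (forall x, \val e x <-> \val f x) -> e = f.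
Proof. by move=> h; apply/val_inj/seteqP; split=> x /h. Qed.

Lemma ev_sub (chi : Omega) e f : \val e `<=` \val f -> ev chi e -> ev chi f.
Proof.
move=> ef; suff -> : e = j_meet e f by rewrite ev_meet => /andP[].
by apply: j_eq => x; split=> [ex|[]//]; split=> //; exact: ef.
Qed.

Lemma j_conj_dom s t : j_conj t (j_dom s) = j_dom (il_mul s t).
Proof.
apply: j_eq => x; rewrite j_conjP; split.
  by move=> [y xy [z yz]]; exists z; exists y.
by move=> [z [y xy yz]]; exists y => //; exists z.
Qed.

Lemma j_conj_ran s : j_conj s (j_dom (il_inv s)) = j_dom s.
Proof.
apply: j_eq => x; rewrite j_conjP; split; first by move=> [y xy _]; exists y.
by move=> [y xy]; exists y => //; exists x.
Qed.

Lemma act_subproof (s : Il) (chi : Omega) : ev chi (j_dom s) ->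
  Omega (fun e => ev chi (j_conj s e)).
Proof.
move=> h; have [[_ _ _] chiU] := set_valP chi; split; first split.
- by exists (j_dom (il_inv s)); rewrite j_conj_ran.
- move=> e f; rewrite -ev_meet; congr (ev chi _).
  apply: j_eq => x; rewrite j_conjP; split.
    by move=> [y xy [ey fy]]; split; apply/j_conjP; exists y.
  move=> [/j_conjP [y xy ey] /j_conjP [y' xy' fy]]; exists y => //.
  by split=> //; rewrite (graph_fun xy xy').
- move=> e e0; apply: ev_empty; apply/seteqP; split=> x //.
  by move=> /j_conjP [y _]; rewrite e0.
- move=> e n f ef he; apply: (chiU _ _ (fun i => j_conj s (f i)) _ he).
  apply/seteqP; split=> x.
    by move=> /j_conjP [y xy]; rewrite ef => -[i _ fy]; exists i => //;
      apply/j_conjP; exists y.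
  move=> [i _ /j_conjP [y xy fy]]; apply/j_conjP; exists y => //.
  by rewrite ef; exists i.
Qed.

(* s.chi = chi(s^{-1} . s) *)
Definition act (s : Il) (chi : Omega) (h : ev chi (j_dom s)) : Omega :=
  exist _ (fun e => ev chi (j_conj s e)) (mem_set (act_subproof h)).

Lemma ev_act s chi (h : ev chi (j_dom s)) e :
  ev (act h) e = ev chi (j_conj s e).
Proof. by []. Qed.

Lemma ev_continuous e : continuous (ev^~ e).
Proof.
move=> chi; apply: (@continuous_comp _ _ _ (\val : Omega -> {ptws J -> bool})
  (fun f : {ptws J -> bool} => f e)).
  exact: initial_continuous.
exact: (@proj_continuous _ (fun _ => bool) e).
Qed.

Lemma ev_open e : open [set chi | ev chi e].
Proof.
rewrite (_ : [set chi | ev chi e] = (ev^~ e) @^-1` [set true]); last first.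
  by apply/seteqP; split.
apply: open_comp; first by move=> ? _; exact: ev_continuous.
exact: discrete_open.
Qed.

Lemma act_open s (U : set Omega) : open U ->
  open [set chi | exists h : ev chi (j_dom s), U (act h)].
Proof.
move=> [A oA <-].
pose F (chi : Omega) : {ptws J -> bool} := fun e => ev chi (j_conj s e).
rewrite (_ : [set _ | _] = [set chi | ev chi (j_dom s)] `&` F @^-1` A).
  apply: openI; first exact: ev_open.
  have Fc : continuous F.
    move=> chi; have FF : Filter (F @ nbhs chi) by exact: fmap_filter.
    apply/cvg_sup => e.
    apply: (@continuous_comp_initial _ Omega _ (fun f : J -> bool => f e) F).
    exact: ev_continuous (j_conj s e).
  by apply: open_comp => // chi _; exact: Fc.
apply/seteqP; split=> chi /=; first by move=> [h].
by move=> [h]; exists h.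
Qed.

End InverseSemigroup.

Arguments Il : clear implicits.
Arguments J : clear implicits.
Arguments Jhat : clear implicits.
Arguments Omega : clear implicits.

Lemma mul_continuousP (A B : topologicalType) (X : Type)
    (src rng : A -> X) (mul : A -> A -> B) :
  {within [set p : A * A | src p.1 = rng p.2],
    continuous (fun p => mul p.1 p.2)} <->
  forall g h, src g = rng h -> forall W, open W -> W (mul g h) ->
    exists U V, [/\ open U, U g, open V, V h & forall g' h', U g' -> V h' ->
      src g' = rng h' -> W (mul g' h')].
Proof.
rewrite subspace_continuousP; split=> [c g h gh W oW Wgh | c [g h] gh W].
  have : nbhs (mul g h) W by exact: open_nbhs_nbhs.
  move=> /(c (g, h) gh) [[U V] [/= + + UVW]].
  rewrite !nbhsE => -[U' [oU' U'g] sU] [V' [oV' V'h] sV].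
  exists U', V'; split => // g' h' Ug Vh e.
  by apply: (UVW (g', h')) => //; split; [exact: sU | exact: sV].
rewrite /= nbhsE => -[W' [oW' W'gh] sW].
have [U [V [oU Ug oV Vh UVW]]] := c _ _ gh _ oW' W'gh.
exists (U, V); first by split; exact: open_nbhs_nbhs.
by move=> [g' h'] [/= Ug' Vh'] e; apply: sW; exact: UVW.
Qed.

(* Étale groupoids, with space of units [unit_space] and space of arrows
   [arrow]. As for categories, [gmul g h] only matters when
   [gsrc g = grng h]. Nothing is assumed to be Hausdorff. *)
Record etale_groupoid := EtaleGroupoid {
  unit_space : topologicalType;
  arrow :> topologicalType;
  gsrc : arrow -> unit_space;
  grng : arrow -> unit_space;
  gunit : unit_space -> arrow;
  gmul : arrow -> arrow -> arrow;
  ginv : arrow -> arrow;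
  gsrc_unit : forall x, gsrc (gunit x) = x;
  grng_unit : forall x, grng (gunit x) = x;
  gsrc_mul : forall g h, gsrc g = grng h -> gsrc (gmul g h) = gsrc h;
  grng_mul : forall g h, gsrc g = grng h -> grng (gmul g h) = grng g;
  gmulA : forall g h k, gsrc g = grng h -> gsrc h = grng k ->
    gmul g (gmul h k) = gmul (gmul g h) k;
  gmul1l : forall g, gmul (gunit (grng g)) g = g;
  gmul1r : forall g, gmul g (gunit (gsrc g)) = g;
  gsrc_inv : forall g, gsrc (ginv g) = grng g;
  grng_inv : forall g, grng (ginv g) = gsrc g;
  gmulVg : forall g, gmul (ginv g) g = gunit (gsrc g);
  gmulgV : forall g, gmul g (ginv g) = gunit (grng g);
  gsrc_continuous : continuous gsrc;
  grng_continuous : continuous grng;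
  gunit_continuous : continuous gunit;
  gmul_continuous : {within [set p : arrow * arrow | gsrc p.1 = grng p.2],
    continuous (fun p => gmul p.1 p.2)};
  ginv_continuous : continuous ginv;
  (* the source map is a local homeomorphism *)
  gsrc_etale : forall g, exists U : set arrow, [/\ open U, U g,
    set_inj U gsrc & forall V, open V -> V `<=` U -> open (gsrc @` V)]
}.

Section TopologicalFreeness.
Variable G : etale_groupoid.

Definition isotropy (x : unit_space G) : set G :=
  [set g | gsrc g = x /\ grng g = x].

(* Since source and range are local homeomorphisms, an open set on which both
   are injective is mapped by both homeomorphically onto an open set. *)
Definition open_bisection (gamma : set G) : Prop :=
  [/\ open gamma, set_inj gamma (@gsrc G) & set_inj gamma (@grng G)].

Definition topologically_free : Prop :=
  forall gamma : set G, open_bisection gamma ->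
    gamma `<=` ~` range (@gunit G) ->
    interior [set x | isotropy x `&` gamma !=set0] = set0.

End TopologicalFreeness.

(* the étale groupoid carried by an open subgroupoid H containing all units *)
Section OpenSubgroupoid.
Variables (G : etale_groupoid) (H : set G).
Hypothesis Hopen : open H.
Hypothesis Hunit : forall x, H (gunit x).
Hypothesis Hmul : forall g h, gsrc g = grng h -> H g -> H h -> H (gmul g h).
Hypothesis Hinv : forall g, H g -> H (ginv g).

Let hunit (x : unit_space G) : H := exist _ (gunit x) (mem_set (Hunit x)).
Let hinv (g : H) : H :=
  exist _ (ginv (\val g)) (mem_set (Hinv (set_valP g))).
Let hmul (g h : H) : H :=
  match pselect (gsrc (\val g) = grng (\val h)) with
  | left e => exist _ (gmul (\val g) (\val h))
                (mem_set (Hmul e (set_valP g) (set_valP h)))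
  | right _ => g
  end.

Let hmulE (g h : H) : gsrc (\val g) = grng (\val h) ->
  \val (hmul g h) = gmul (\val g) (\val h).
Proof. by move=> e; rewrite /hmul; case: pselect. Qed.

Let val_continuous : continuous (\val : H -> G).
Proof. exact: initial_continuous. Qed.

Definition open_subgroupoid : etale_groupoid.
Proof.
refine (@EtaleGroupoid (unit_space G) H
  (fun g => gsrc (\val g)) (fun g => grng (\val g)) hunit hmul hinv
  _ _ _ _ _ _ _ _ _ _ _ _ _ _ _ _ _).
- by move=> x; rewrite /= gsrc_unit.
- by move=> x; rewrite /= grng_unit.
- by move=> g h gh; rewrite hmulE // gsrc_mul.
- by move=> g h gh; rewrite hmulE // grng_mul.
- move=> g h k gh hk; apply: val_inj.
  by rewrite !hmulE ?gmulA // ?gsrc_mul ?grng_mul.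
- by move=> g; apply: val_inj; rewrite hmulE /= ?gmul1l // gsrc_unit.
- by move=> g; apply: val_inj; rewrite hmulE /= ?gmul1r // grng_unit.
- by move=> g; rewrite /= gsrc_inv.
- by move=> g; rewrite /= grng_inv.
- by move=> g; apply: val_inj; rewrite hmulE /= ?gmulVg // gsrc_inv.
- by move=> g; apply: val_inj; rewrite hmulE /= ?gmulgV // grng_inv.
- move=> g; apply: continuous_comp; first exact: val_continuous.
  exact: gsrc_continuous.
- move=> g; apply: continuous_comp; first exact: val_continuous.
  exact: grng_continuous.
- apply: continuous_comp_initial => x; exact: gunit_continuous.
- apply (mul_continuousP (A:=H) (B:=H) (fun g => gsrc (\val g)) (fun g => grng (\val g)) hmul).
  move=> g h gh W [W' oW' <-]; rewrite set_valE /preimage /= hmulE // => W'gh.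
  have [U [V [oU Ug oV Vh UVW]]] :=
    (mul_continuousP _ _ _).1 (@gmul_continuous G) _ _ gh _ oW' W'gh.
  exists (\val @^-1` U), (\val @^-1` V); split => //.
  + by apply: open_comp => // ? _; exact: val_continuous.
  + by apply: open_comp => // ? _; exact: val_continuous.
  + by move=> g' h' Ug' Vh' e; rewrite /= hmulE //; exact: UVW.
- apply: continuous_comp_initial => g.
  apply: (@continuous_comp H G G \val (@ginv G)).
    exact: val_continuous.
  exact: ginv_continuous.
- move=> g; have [U [oU Ug Ui Uo]] := gsrc_etale (\val g).
  exists (\val @^-1` U); split => //.
  + by apply: open_comp => // ? _; exact: val_continuous.
  + move=> x y /set_mem xU /set_mem yU xy; apply: val_inj.
    by apply: Ui => //; apply: mem_set.
  + move=> V [W oW WV] VU.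
    rewrite (_ : [set _ | _ in _] = (@gsrc G) @` (W `&` H `&` U)).
      by apply: Uo => [|? []//]; apply: openI => //; exact: openI.
    apply/seteqP; split=> [_ [x Vx <-] | _ [y [[Wy Hy] Uy] <-]].
      exists (\val x) => //; split; last exact: VU.
      by split; [rewrite -WV in Vx | exact: set_valP].
    by exists (exist _ y (mem_set Hy)) => //; rewrite -WV.
Defined.

End OpenSubgroupoid.

Section TransformationGroupoid.
Variable C : left_cancellative_category.
Implicit Types (s t : Il C) (chi psi : Omega C).

Definition pregerm : Type := {p : Il C * Omega C | ev p.2 (j_dom p.1)}.

HB.instance Definition _ := Choice.on pregerm.

Definition germ_rel (p q : pregerm) : bool :=
  `[< (\val p).2 = (\val q).2 /\ exists e : J C, ev (\val p).2 e /\
      pcomp (\val (\val p).1) (pid (\val e)) =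
      pcomp (\val (\val q).1) (pid (\val e)) >].

Lemma pcomp_pidP (T : Type) (s t : partial_bij T) (A : set T) :
  pcomp s (pid A) = pcomp t (pid A) <->
  forall x y, A x -> graph s x y <-> graph t x y.
Proof.
have aux (r : partial_bij T) x y : A x -> graph (pcomp r (pid A)) x y <-> graph r x y.
  by move=> Ax; split; [move=> [z [_ <-]] | move=> rxy; exists x].
split=> [st x y Ax | st].
  by rewrite -(aux s) // -(aux t) // st.
apply: partial_bijP => x y.
by split=> -[z [Az <-]] h; exists x => //; apply/(st x y Az).
Qed.

Lemma germ_rel_equiv : equiv_class_of germ_rel.
Proof.
split.
- move=> [[s chi] h]; apply/asboolP; split => //.
  by have [e he] := ev_ex chi; exists e.
- have sym p q : germ_rel p q -> germ_rel q p.
    move=> /asboolP [e [f [hf ef]]]; apply/asboolP; split; first by rewrite e.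
    by exists f; rewrite -e; split.
  by move=> p q; apply/idP/idP; exact: sym.
- move=> q p r /asboolP [e1 [f1 [h1 g1]]] /asboolP [e2 [f2 [h2 g2]]].
  apply/asboolP; split; first by rewrite e1.
  exists (j_meet f1 f2); rewrite ev_meet h1 e1 h2; split => //.
  move/pcomp_pidP: g1 => g1; move/pcomp_pidP: g2 => g2.
  by apply/pcomp_pidP => x y [x1 x2]; exact: iff_trans (g1 x y x1) (g2 x y x2).
Qed.

Canonical germ_equiv := EquivRelPack germ_rel_equiv.

Definition germs := {eq_quot germ_equiv}.

HB.instance Definition _ := Choice.on germs.

(* [s, chi] *)
Definition germ (s : Il C) (chi : Omega C) (h : ev chi (j_dom s)) : germs :=
  \pi_germs (exist _ (s, chi) h).

Lemma germP (g : germs) : exists s chi (h : ev chi (j_dom s)), g = germ h.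
Proof.
rewrite -[g]reprK; case: (repr g) => -[s chi] h.
by exists s, chi, h.
Qed.

Lemma germ_eqP s t chi psi (h : ev chi (j_dom s)) (k : ev psi (j_dom t)) :
  germ h = germ k <-> chi = psi /\ exists e : J C, ev chi e /\
    pcomp (\val s) (pid (\val e)) = pcomp (\val t) (pid (\val e)).
Proof.
rewrite /germ; split; first by move=> /eqmodP /asboolP.
by move=> st; apply/eqmodP/asboolP.
Qed.

Lemma germ_irr s chi (h k : ev chi (j_dom s)) : germ h = germ k.
Proof. by rewrite (bool_irrelevance h k). Qed.

(* A set of germs is open iff its intersection with every
   {[s, chi] : chi in Omega(s^{-1}s)}, read in Omega via the source map, is
   open; this is the topology making these sets open and the source map a
   homeomorphism on each of them. *)
Definition germ_open (W : set germs) : Prop :=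
  forall s : Il C, open [set chi | exists h : ev chi (j_dom s), W (germ h)].

Lemma germ_openT : germ_open setT.
Proof.
move=> s; rewrite (_ : [set _ | _] = [set chi | ev chi (j_dom s)]).
  exact: ev_open.
by apply/seteqP; split=> chi; [move=> [] | move=> h; exists h].
Qed.

Lemma germ_openI : setI_closed germ_open.
Proof.
move=> V W oV oW s.
rewrite (_ : [set _ | _] =
  [set chi | exists h : ev chi (j_dom s), V (germ h)] `&`
  [set chi | exists h : ev chi (j_dom s), W (germ h)]); first exact: openI.
apply/seteqP; split=> chi; first by move=> [h [Vh Wh]]; split; exists h.
by move=> [[h Vh] [k Wk]]; exists h; split => //; rewrite (germ_irr h k).
Qed.

Lemma germ_open_bigU (I : Type) (f : I -> set germs) :
  (forall i, germ_open (f i)) -> germ_open (\bigcup_i f i).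
Proof.
move=> of_ s; rewrite (_ : [set _ | _] =
  \bigcup_i [set chi | exists h : ev chi (j_dom s), f i (germ h)]).
  by apply: bigcup_open => i _; exact: of_.
apply/seteqP; split=> chi; first by move=> [h [i _ fi]]; exists i => //; exists h.
by move=> [i _ [h fi]]; exists h, i.
Qed.

HB.instance Definition _ :=
  isOpenTopological.Build germs germ_openT germ_openI germ_open_bigU.

Lemma open_germsE (W : set germs) : open W <-> germ_open W.
Proof. by []. Qed.

Definition slice (s : Il C) (U : set (Omega C)) : set germs :=
  [set g | exists chi (h : ev chi (j_dom s)), U chi /\ g = germ h].

Lemma slice_open s U : open U -> open (slice s U).
Proof.
move=> oU; apply/open_germsE => t.
rewrite (_ : [set _ | _] = U `&` [set chi | ev chi (j_dom s)] `&`
  [set chi | ev chi (j_dom t)] `&`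
  \bigcup_(e in [set e : J C | pcomp (\val s) (pid (\val e)) =
      pcomp (\val t) (pid (\val e))]) [set chi | ev chi e]).
  apply: openI; first apply: openI; first apply: openI => //.
  - exact: ev_open.
  - exact: ev_open.
  - by apply: bigcup_open => e _; exact: ev_open.
apply/seteqP; split=> chi.
  move=> [h [psi [k [Upsi /germ_eqP [e [f [hf tf]]]]]]]; subst psi.
  by split=> //; exists f.
move=> [[[Uchi h] k] [e /= se he]]; exists k, chi, h; split=> //.
by apply/germ_eqP; split=> //; exists e.
Qed.

Definition germ_src (g : germs) : Omega C := (\val (repr g)).2.

Definition germ_rng (g : germs) : Omega C := act (valP (repr g)).

Lemma repr_germ s chi (h : ev chi (j_dom s)) :
  exists t (k : ev chi (j_dom t)), repr (germ h) = exist _ (t, chi) k /\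
    exists e : J C, ev chi e /\
    pcomp (\val s) (pid (\val e)) = pcomp (\val t) (pid (\val e)).
Proof.
have := reprK (germ h); case: (repr (germ h)) => -[t psi] k.
move=> /esym /germ_eqP [e st]; subst psi; exists t, k; split=> //.
Qed.

Lemma germ_srcE s chi (h : ev chi (j_dom s)) : germ_src (germ h) = chi.
Proof. by rewrite /germ_src; have [t [k [-> _]]] := repr_germ h. Qed.

Lemma ev_local (chi : Omega C) (e f k : J C) : ev chi k ->
  (forall x, \val k x -> \val e x <-> \val f x) -> ev chi e = ev chi f.
Proof.
move=> hk ef; have : ev chi (j_meet e k) = ev chi (j_meet f k).
  by congr (ev chi _); apply: j_eq => x; split=> -[ex kx]; split=> //; apply/(ef x kx).
by rewrite !ev_meet hk !andbT.
Qed.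

Lemma act_local s t chi (h : ev chi (j_dom s)) (k : ev chi (j_dom t)) e :
  ev chi e ->
  pcomp (\val s) (pid (\val e)) = pcomp (\val t) (pid (\val e)) ->
  act h = act k.
Proof.
move=> he /pcomp_pidP st; apply: omega_eq => f; rewrite !ev_act.
apply: (ev_local he) => x ex; rewrite !j_conjP.
by split=> -[y xy fy]; exists y => //; apply/(st x y ex).
Qed.

Lemma germ_rngE s chi (h : ev chi (j_dom s)) : germ_rng (germ h) = act h.
Proof.
rewrite /germ_rng; have [t [k [-> [e [he st]]]]] := repr_germ h.
by apply/esym; apply: act_local he st.
Qed.

Lemma ev_dom_mul s t chi (h : ev chi (j_dom t)) :
  ev (act h) (j_dom s) = ev chi (j_dom (il_mul s t)).
Proof. by rewrite ev_act j_conj_dom. Qed.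

Lemma act_mul s t chi (h : ev chi (j_dom t)) (k : ev (act h) (j_dom s))
  (l : ev chi (j_dom (il_mul s t))) : act k = act l.
Proof.
apply: omega_eq => e; rewrite !ev_act; congr (ev chi _); apply: j_eq => x.
rewrite !j_conjP; split.
  by move=> [y xy /j_conjP [z yz ez]]; exists z => //; exists y.
move=> [z [y xy yz] ez]; exists y => //; apply/j_conjP; by exists z.
Qed.

Lemma ev_inv s chi (h : ev chi (j_dom s)) : ev (act h) (j_dom (il_inv s)).
Proof. by rewrite ev_act j_conj_ran. Qed.

Lemma act_inv s chi (h : ev chi (j_dom s)) (k : ev (act h) (j_dom (il_inv s))) :
  act k = chi.
Proof.
apply: omega_eq => e; rewrite !ev_act; apply: (ev_local h) => x [y xy].
rewrite j_conjP; split.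
  move=> [z xz /j_conjP [w zw ew]].
  by rewrite (graph_inj xz zw).
by move=> ex; exists y => //; apply/j_conjP; exists x.
Qed.

Lemma ev_il_id e (chi : Omega C) : ev chi e -> ev chi (j_dom (il_id e)).
Proof. by apply: ev_sub => x ex; exists x. Qed.

Lemma act_il_id e chi (h : ev chi (j_dom (il_id e))) : act h = chi.
Proof.
apply: omega_eq => f; rewrite ev_act; apply: (ev_local h) => x [y [ex _]].
by rewrite j_conjP; split=> [[z [_ <-]]|fx] //; exists x.
Qed.

Lemma mul_subproof (g h : germs) : germ_src g = germ_rng h ->
  ev (\val (repr h)).2 (j_dom (il_mul (\val (repr g)).1 (\val (repr h)).1)).
Proof.
rewrite /germ_src /germ_rng => e; rewrite -(ev_dom_mul _ (valP (repr h))) -e.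
exact: valP (repr g).
Qed.

(* [s, t.chi] [t, chi] = [s t, chi], see [germ_mulE] *)
Definition germ_mul (g h : germs) : germs :=
  match pselect (germ_src g = germ_rng h) with
  | left e => germ (mul_subproof e)
  | right _ => g
  end.

Lemma germ_mulE s t chi psi (h : ev chi (j_dom t)) (k : ev psi (j_dom s))
    (l : ev chi (j_dom (il_mul s t))) : psi = act h ->
  germ_mul (germ k) (germ h) = germ l.
Proof.
move=> epsi; subst psi; rewrite /germ_mul; case: pselect; last first.
  by rewrite germ_srcE germ_rngE.
move=> e; apply/germ_eqP; move: (mul_subproof e).
have [t' [h' [-> [f [hf tf]]]]] := repr_germ h.
have [s' [k' [-> [f' [hf' sf]]]]] := repr_germ k => /= _.
split=> //; exists (j_meet f (j_conj t f')); rewrite ev_meet hf -(ev_act h) hf'.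
move/pcomp_pidP: tf => tf; move/pcomp_pidP: sf => sf.
split=> //; apply/pcomp_pidP => x z [fx /j_conjP [y xy fy]]; split.
  move=> [w xw wz]; have xw' : graph (\val t) x w by apply/(tf x w fx).
  by exists w => //; apply/(sf w z) => //; rewrite (graph_fun xw' xy).
move=> [w xw wz]; exists w; first exact/(tf x w fx).
by apply/(sf w z) => //; rewrite (graph_fun xw xy).
Qed.

(* [s, chi]^{-1} = [s^{-1}, s.chi] *)
Definition germ_inv (g : germs) : germs := germ (ev_inv (valP (repr g))).

Lemma germ_invE s chi psi (h : ev chi (j_dom s))
    (k : ev psi (j_dom (il_inv s))) : psi = act h ->
  germ_inv (germ h) = germ k.
Proof.
move=> epsi; subst psi; rewrite /germ_inv; apply/germ_eqP.
have [t [h' [-> [e [he st]]]]] := repr_germ h => /=.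
have a (l : ev chi (j_dom t)) : act l = act h := act_local l h he (esym st).
split; first exact: a.
have hh : ev (act h) (j_conj (il_inv s) e).
  rewrite ev_act; move: (h); rewrite (@ev_local _ _ (j_conj s (j_conj (il_inv s) e)) e he) //.
  move=> x ex; split; last by move=> /j_conjP [y xy _]; exists y.
  by move=> [y xy]; apply/j_conjP; exists y => //; apply/j_conjP; exists x.
exists (j_conj (il_inv s) e); split; first by rewrite [act _]a.
move/pcomp_pidP: st => st.
apply/pcomp_pidP => y x /j_conjP [z yz ez] /=; split=> xy.
  have zy : graph (\val t) z y by apply/st.
  by rewrite (graph_inj xy zy).
by rewrite (graph_inj xy yz); apply/st.
Qed.

Definition germ_unit (chi : Omega C) : germs :=
  germ (ev_il_id (projT2 (cid (ev_ex chi)))).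

(* the unit at chi is [e, chi] for any idempotent e with chi(e) = 1 *)
Lemma germ_unitE e chi (h : ev chi (j_dom (il_id e))) :
  germ_unit chi = germ h.
Proof.
have he : ev chi e by move: h; apply: ev_sub => x [y []].
apply/germ_eqP; split=> //; case: (cid _) => f hf /=.
exists (j_meet f e); rewrite ev_meet hf he; split=> //.
by apply/pcomp_pidP => x y [fx ex] /=; split=> -[].
Qed.

Definition transformation_groupoid : etale_groupoid.
Proof.
refine (@EtaleGroupoid (Omega C) germs germ_src germ_rng germ_unit
  germ_mul germ_inv _ _ _ _ _ _ _ _ _ _ _ _ _ _ _ _ _).
- by move=> x; rewrite germ_srcE.
- by move=> x; rewrite germ_rngE act_il_id.
- by move=> g h e; rewrite /germ_mul; case: pselect => // e'; rewrite germ_srcE.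
- move=> g h; have [s [psi [k ->]]] := germP g; have [t [chi [l ->]]] := germP h.
  rewrite germ_srcE !germ_rngE => e; subst psi.
  have m : ev chi (j_dom (il_mul s t)) by rewrite -(ev_dom_mul s l).
  by rewrite (germ_mulE k m) // germ_rngE (act_mul k m).
- move=> g h j; have [r [phi [a ->]]] := germP g.
  have [s [psi [b ->]]] := germP h; have [t [chi [c ->]]] := germP j.
  rewrite !germ_srcE !germ_rngE => e e'; subst phi psi.
  have st : ev chi (j_dom (il_mul s t)) by rewrite -(ev_dom_mul s c).
  have rs : ev (act c) (j_dom (il_mul r s)) by rewrite -(ev_dom_mul r b).
  have rst : ev chi (j_dom (il_mul r (il_mul s t))).
    by rewrite -(ev_dom_mul r st) -(act_mul b st).
  have rst' : ev chi (j_dom (il_mul (il_mul r s) t)).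
    by rewrite -(ev_dom_mul (il_mul r s) c).
  rewrite (germ_mulE b st) // (germ_mulE a rst) ?(act_mul b st) //.
  rewrite (germ_mulE a rs) // (germ_mulE rs rst') //.
  apply/germ_eqP; split=> //; exists (j_dom t); split=> //=.
  by rewrite pcompA.
- move=> g; have [s [chi [h ->]]] := germP g; rewrite germ_rngE.
  have k : ev (act h) (j_dom (il_id (j_dom (il_inv s)))).
    by apply: ev_il_id; exact: ev_inv.
  have l : ev chi (j_dom (il_mul (il_id (j_dom (il_inv s))) s)).
    by rewrite -(ev_dom_mul _ h).
  rewrite (germ_unitE k) (germ_mulE k l) //.
  apply/germ_eqP; split=> //; exists (j_dom s); split=> //.
  apply/pcomp_pidP => x y _ /=; split; first by move=> [z xz [_ <-]].
  by move=> xy; exists y => //; split=> //; exists x.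
- move=> g; have [s [chi [h ->]]] := germP g; rewrite germ_srcE.
  have k : ev chi (j_dom (il_id (j_dom s))) by exact: ev_il_id.
  have k' : ev (act k) (j_dom s) by rewrite act_il_id.
  have l : ev chi (j_dom (il_mul s (il_id (j_dom s)))).
    by rewrite -(ev_dom_mul _ k).
  rewrite (germ_unitE k) (germ_mulE h l) ?act_il_id //.
  apply/germ_eqP; split=> //; exists (j_dom s); split=> //.
  apply/pcomp_pidP => x y xs /=; split; first by move=> [z [_ <-]].
  by move=> xy; exists x.
- by move=> g; rewrite germ_srcE.
- move=> g; have [s [chi [h ->]]] := germP g.
  by rewrite (germ_invE (ev_inv h)) // germ_rngE germ_srcE act_inv.
- move=> g; have [s [chi [h ->]]] := germP g; rewrite germ_srcE.
  have k : ev chi (j_dom (il_mul (il_inv s) s)).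
    by rewrite -(ev_dom_mul _ h); exact: ev_inv.
  rewrite (germ_invE (ev_inv h)) // (germ_mulE _ k) //.
  have l : ev chi (j_dom (il_id (j_dom s))) by exact: ev_il_id.
  rewrite (germ_unitE l); apply/germ_eqP; split=> //.
  by exists (j_dom s); split=> //=; rewrite pid_pdom.
- move=> g; have [s [chi [h ->]]] := germP g; rewrite germ_rngE.
  have e : chi = act (ev_inv h) by rewrite act_inv.
  have k : ev (act h) (j_dom (il_mul s (il_inv s))).
    by rewrite -(ev_dom_mul _ (ev_inv h)) -e.
  rewrite (germ_invE (ev_inv h)) // (germ_mulE h k) //.
  have l : ev (act h) (j_dom (il_id (j_dom (il_inv s)))).
    by apply: ev_il_id; exact: ev_inv.
  rewrite (germ_unitE l); apply/germ_eqP; split=> //.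
  exists (j_dom (il_inv s)); split=> //; first exact: ev_inv.
  by rewrite /= pid_pdom pinvK.
- apply/continuousP => U oU; apply/open_germsE => s.
  rewrite (_ : [set _ | _] = U `&` [set chi | ev chi (j_dom s)]).
    by apply: openI => //; exact: ev_open.
  apply/seteqP; split=> chi /=; first by move=> [h]; rewrite germ_srcE.
  by move=> [Uchi h]; exists h; rewrite /= germ_srcE.
- apply/continuousP => U oU; apply/open_germsE => s.
  rewrite (_ : [set _ | _] = [set chi | exists h : ev chi (j_dom s), U (act h)]).
    exact: act_open.
  by apply/seteqP; split=> chi [h Uh]; exists h; move: Uh; rewrite /= germ_rngE.
- apply/continuousP => W oW; rewrite openE => chi Wchi; rewrite /interior.
  have [e he] := ev_ex chi; have h := ev_il_id he.
  apply: (filterS (P := [set psi | exists k : ev psi (j_dom (il_id e)), W (germ k)])).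
    by move=> psi [k Wk]; rewrite /preimage /= (germ_unitE k).
  apply: open_nbhs_nbhs; split; first exact: oW.
  by exists h; rewrite -(germ_unitE h).
- apply (mul_continuousP (A:=germs) (B:=germs) germ_src germ_rng germ_mul).
  move=> g h; have [s [psi [k ->]]] := germP g; have [t [chi [l ->]]] := germP h.
  rewrite germ_srcE germ_rngE => e; subst psi => W oW.
  have m : ev chi (j_dom (il_mul s t)) by rewrite -(ev_dom_mul s l).
  rewrite (germ_mulE k m) // => Wm.
  exists (slice s setT), (slice t
    [set phi | exists n : ev phi (j_dom (il_mul s t)), W (germ n)]).
  split.
  + by apply: slice_open; exact: openT.
  + by exists (act l), k.
  + by apply: slice_open; exact: oW.
  + by exists chi, l; split=> //; exists m.
  + move=> g' h' [psi [k' [_ ->]]] [phi [l' [[n Wn] ->]]].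
    by rewrite germ_srcE germ_rngE => e; rewrite (germ_mulE k' n).
- apply/continuousP => W oW; apply/open_germsE => s.
  rewrite (_ : [set _ | _] = [set chi | exists h : ev chi (j_dom s),
    exists k : ev (act h) (j_dom (il_inv s)), W (germ k)]).
    apply: (@act_open C s
      [set psi | exists k : ev psi (j_dom (il_inv s)), W (germ k)]).
    exact: oW.
  apply/seteqP; split=> chi [h].
    by rewrite /preimage /= (germ_invE (ev_inv h)) //; exists h, (ev_inv h).
  move=> [k Wk]; exists h; rewrite /preimage /= (germ_invE (ev_inv h)) //.
  by rewrite (germ_irr _ k).
- move=> g; have [s [chi [h ->]]] := germP g; exists (slice s setT); split.
  + by apply: slice_open; exact: openT.
  + by exists chi, h.
  + move=> _ _ /set_mem [psi [k [_ ->]]] /set_mem [phi [l [_ ->]]].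
    rewrite !germ_srcE => e; subst phi; exact: germ_irr.
  + move=> V oV Vs; rewrite (_ : [set _ | _ in _] =
      [set psi | exists k : ev psi (j_dom s), V (germ k)]); first exact: oV.
    apply/seteqP; split=> [_ [g' Vg' <-] | psi [k Vk]].
      have [psi [k [_ e]]] := Vs _ Vg'; subst g'.
      by rewrite -/(germ_src (germ k)) germ_srcE; exists k.
    by exists (germ k) => //; exact: germ_srcE.
Defined.

(* the germs [u, chi] with u in C^{*,0} *)
Definition loop_germs : set germs :=
  [set g | exists (u : C) (chi : Omega C) (h : ev chi (j_dom (il_lmul u))),
     loop_units u /\ g = germ h].

Lemma loop_germs_open : open loop_germs.
Proof.
rewrite (_ : loop_germs =
  \bigcup_(u in loop_units (C := C)) slice (il_lmul u) setT).
  by apply: bigcup_open => u _; apply: slice_open; exact: openT.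
apply/seteqP; split=> g.
  by move=> [u [chi [h [uC ->]]]]; exists u => //; exists chi, h.
by move=> [u uC [chi [h [_ ->]]]]; exists u, chi, h.
Qed.

Lemma loop_units_id (v : cobj C) : loop_units (cidm v).
Proof.
split; last by rewrite cdom_id ctgt_id.
have e : cmul (cidm v) (cidm v) = cidm v by rewrite -{1}(ctgt_id v) cmul1l.
by exists (cidm v); rewrite cdom_id ctgt_id e.
Qed.

Lemma lmul_graphE (c x y : C) :
  graph (lmul c) x y <-> ctgt x = cdom c /\ y = cmul c x.
Proof. by rewrite /= principalE. Qed.

Lemma il_lmul_mul (c d : C) : cdom c = ctgt d ->
  il_lmul (cmul c d) = il_mul (il_lmul c) (il_lmul d).
Proof.
move=> cd; apply/val_inj/partial_bijP => x y; rewrite lmul_graphE; split.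
  move=> [xd ->]; rewrite cdom_mul // in xd.
  exists (cmul d x); apply/lmul_graphE; split; rewrite ?ctgt_mul //.
  by rewrite cmulA.
move=> [z /lmul_graphE [xd ->] /lmul_graphE [zc ->]].
by rewrite cdom_mul // cmulA.
Qed.

Lemma il_lmul_id (v : cobj C) : il_lmul (cidm v) = il_id (j_principal v).
Proof.
apply/val_inj/partial_bijP => x y; rewrite lmul_graphE cdom_id.
rewrite [\val (il_id _)]/(pid (principal v)) principalE /=.
by split=> [[xv ->]|[xv <-]]; subst v; rewrite cmul1l.
Qed.

Lemma loop_germs_unit chi : loop_germs (germ_unit chi).
Proof.
have [e he] := ev_ex chi; have [v ev_] := J_sub_principal (set_valP e).
have hv : ev chi (j_principal v) by apply: ev_sub he.
have h : ev chi (j_dom (il_lmul (cidm v))).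
  by rewrite il_lmul_id; exact: ev_il_id.
exists (cidm v), chi, h; split; first exact: loop_units_id.
rewrite (germ_unitE (ev_il_id hv)); apply/germ_eqP; split=> //.
by exists (j_principal v); split=> //; rewrite il_lmul_id.
Qed.

Lemma loop_germs_mul g h : germ_src g = germ_rng h ->
  loop_germs g -> loop_germs h -> loop_germs (germ_mul g h).
Proof.
move=> + [u [psi [k [[[u' [uu' u'u e1 e2]] uo] eg]]]].
move=> + [w [chi [l [[[w' [ww' w'w e3 e4]] wo] eh]]]]; subst g h.
rewrite germ_srcE germ_rngE => e; subst psi.
have m : ev chi (j_dom (il_mul (il_lmul u) (il_lmul w))).
  by rewrite -(ev_dom_mul _ l).
have [x [z [y /lmul_graphE [xw ->] /lmul_graphE [uw _]]]] :
    exists x, \val (j_dom (il_mul (il_lmul u) (il_lmul w))) x.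
  have [e0|/set0P //] := eqVneq (\val (j_dom (il_mul (il_lmul u) (il_lmul w)))) set0.
  by rewrite (ev_empty _ e0) in m.
rewrite ctgt_mul // in uw.
have n : ev chi (j_dom (il_lmul (cmul u w))).
  by rewrite il_lmul_mul.
exists (cmul u w), chi, n; split.
  split; last by rewrite ctgt_mul // cdom_mul // -wo uo.
  have w'u' : cdom w' = ctgt u' by rewrite w'w uw uu'.
  exists (cmul w' u'); split.
  + by rewrite cdom_mul // ctgt_mul.
  + by rewrite cdom_mul // ctgt_mul.
  + rewrite ctgt_mul // -cmulA ?ctgt_mul // (cmulA ww') // e3.
    by rewrite uw uu' cmul1l.
  + rewrite cdom_mul // -cmulA ?ctgt_mul // (cmulA u'u) // e2.
    by rewrite -uw cmul1l.
rewrite (germ_mulE k m) //; apply/germ_eqP; split=> //.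
by exists (j_dom (il_lmul w)); split=> //; rewrite il_lmul_mul.
Qed.

Lemma loop_germs_inv g : loop_germs g -> loop_germs (germ_inv g).
Proof.
move=> [u [chi [h [[[u' [uu' u'u e1 e2]] uo] ->]]]].
have inv_u : il_lmul u' = il_inv (il_lmul u).
  apply/val_inj/partial_bijP => x y; rewrite lmul_graphE [graph _ _ _]lmul_graphE.
  split=> [[xu' ->] | [yu ->]].
    by rewrite ctgt_mul // cmulA // e1 -u'u -xu' cmul1l.
  by rewrite ctgt_mul // cmulA // e2 -yu cmul1l.
have k : ev (act h) (j_dom (il_lmul u')).
  by rewrite inv_u; exact: ev_inv.
exists u', (act h), k; split.
  split; last by rewrite -uu' u'u.
  by exists u; split=> //; rewrite -?uu' ?u'u.
rewrite (germ_invE (ev_inv h)) //; apply/germ_eqP; split=> //.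
by exists (j_dom (il_inv (il_lmul u))); split; [exact: ev_inv | rewrite inv_u].
Qed.

(* C^{*,0} ⋉ Omega *)
Definition loop_groupoid : etale_groupoid :=
  @open_subgroupoid transformation_groupoid loop_germs loop_germs_open
    loop_germs_unit loop_germs_mul loop_germs_inv.

End TransformationGroupoid.

(* Main.v *)
Require Import Defs.
From mathcomp Require Import all_boot.
From mathcomp Require Import all_classical.
From mathcomp Require Import topology.

Local Open Scope classical_set_scope.

(** Every morphism [z] gives a character [point_char z] in Omega, the indicator
of the constructible right ideals containing [z]. These characters describe
the groupoid completely enough for the theorem:
- they are dense in Omega: this is what the defining condition of Omega says,
  since a basic open set containing no [point_char z] would exhibit an ideal as
  a finite union of ideals on none of which the character is 1
  ([cylinder_point]);
- elements of I_l commute with right multiplication ([Il_equivariant]), so [s]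
  maps [point_char z] to [point_char (s z)] ([act_point]), and the germ of [s]
  at [point_char z] is a unit exactly when [s z = z] ([germ_point_unit]);
- [point_char x = point_char y] exactly when [y] lies in [x C^*]
  ([point_char_eqP]).

I => II holds for any open subgroupoid, because its open bisections are open
bisections of the whole groupoid ([open_subgroupoid_topologically_free]).

II => III ([loop_free_units_fix_points]): let [X] be the set of morphisms in
[v C] outside all [f_i]. If [u z] lies in [z C^*] for all [z] in [X], then [u]
fixes every [point_char z] with [z] in [X], hence by density it fixes the whole
basic open set cut out by [v C] and the [f_i]. This set contains the character
of the identity at [v], which lies in no proper subideal of [v C]. If [u] had
no fixed point in [X], the germs of [u] over this set would form an open
bisection consisting of nontrivial isotropy over a nonempty open set.

III => I ([units_fix_points_free]): given an open bisection outside the unit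
space which has isotropy over a nonempty open set, shrink this set to a basic
one over which the bisection consists of the germs of a single [s]. Pick [z]
with [point_char z] inside. Since [s] fixes [point_char z], we have
[s z = z u] for a unit [u] at the domain of [z], and equivariance gives
[s (z y) = z (u y)]. Thus [u] satisfies the hypothesis of III with respect to
the ideals [z^-1 f_i], where the [f_i] are the ideals excluded by the basic
set; a fixed point [x] of [u] yields the fixed point [z x] of [s], hence a unit
in the bisection. *)

(** * Equivariance of the inverse semigroup *)

Section PointCharacters.
Set Implicit Arguments.
Unset Strict Implicit.
Unset Printing Implicit Defensive.
Variable C : left_cancellative_category.

(** Both parts are needed simultaneously in the induction: equality of the
domains is what lets the second part pass to inverses. *)
Lemma Il_equivariant (s : partial_bij C) : Il C s -> forall x y, graph s x y ->
  cdom x = cdom y /\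
  forall c, ctgt c = cdom x -> graph s (cmul x c) (cmul y c).
Proof.
elim=> {s} [d | s t _ IHs _ IHt | s _ IHs] x y.
- move=> /lmul_graphE [xd ->]; split=> [|c cx]; first by rewrite cdom_mul.
  by apply/lmul_graphE; rewrite ctgt_mul // cmulA.
- move=> [z /IHt [xz tc] /IHs [zy sc]]; split=> [|c cx]; first by rewrite xz.
  by exists (cmul z c); [exact: tc | apply: sc; rewrite -xz].
- by move=> /IHs [yx sc]; split=> // c cx; apply: sc; rewrite yx.
Qed.

Lemma J_right_ideal (e : J C) x c :
  \val e x -> ctgt c = cdom x -> \val e (cmul x c).
Proof.
case: e => e /= eJ; have [s sI <-] := set_mem eJ; move=> [y xy] cx.
by exists (cmul y c); apply: (Il_equivariant sI xy).2.
Qed.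

Lemma unit_orbit_sym (x y : C) : lmul_set x (@invertible C) y ->
  lmul_set y (@invertible C) x.
Proof.
move=> [c [[c' [cc' c'c ccE c'cE]] cx] <-].
exists c'; last by rewrite -cmulA // ccE cx cmul1r.
split; last by rewrite cdom_mul.
by exists c; split; rewrite // ?c'c -?cc'.
Qed.

(** The ideal [x C] belongs to J as the range of left multiplication by [x],
that is, the domain of its inverse. *)
Definition right_ideal (x : C) : J C := j_dom (il_inv (il_lmul x)).

Lemma right_idealP x y : \val (right_ideal x) y <->
  exists2 c, ctgt c = cdom x & y = cmul x c.
Proof.
split; first by move=> [c /lmul_graphE [cx ->]]; exists c.
by move=> [c cx ->]; exists c; apply/lmul_graphE.
Qed.

Lemma right_ideal_refl x : \val (right_ideal x) x.
Proof.
by apply/right_idealP; exists (cidm (cdom x)); rewrite ?ctgt_id ?cmul1r.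
Qed.

(** * Point characters *)

Lemma point_char_subproof (z : C) : Omega C (fun e => `[< \val e z >]).
Proof.
split; first split.
- exists (j_principal (ctgt z)); apply/asboolP.
  by rewrite /= principalE.
- move=> e f; apply/asboolP/andP => [[ez fz]|[/asboolP ez /asboolP fz]] //.
  by split; apply/asboolP.
- by move=> e e0; apply/asboolP; rewrite e0.
- move=> e n f ef /asboolP; rewrite ef => -[i _ fz]; exists i.
  exact/asboolP.
Qed.

Definition point_char (z : C) : Omega C :=
  exist _ (fun e => `[< \val e z >]) (mem_set (point_char_subproof z)).

Lemma ev_point z e : ev (point_char z) e <-> \val e z.
Proof. by split=> [/asboolP|ez] //; apply/asboolP. Qed.

(** This turns the action of I_l on Omega into evaluation of partial
bijections on a dense set of characters. *)
Lemma act_point (s : Il C) z y (h : ev (point_char z) (j_dom s)) :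
  graph (\val s) z y -> act h = point_char y.
Proof.
move=> zy; apply: omega_eq => e; rewrite ev_act.
apply/idP/idP => [/ev_point /j_conjP [y' zy' ey'] | /ev_point ey].
  by apply/ev_point; rewrite (graph_fun zy zy').
by apply/ev_point/j_conjP; exists y.
Qed.

(** Two points lie in the same constructible ideals exactly when each lies in
the principal right ideal of the other; left cancellation then makes the two
factors mutually inverse. *)
Lemma point_char_eqP (x y : C) :
  point_char x = point_char y <-> lmul_set x (@invertible C) y.
Proof.
split=> [exy|xy]; last first.
  have sub a b : lmul_set a (@invertible C) b ->
      forall e, ev (point_char a) e -> ev (point_char b) e.
    by move=> [c [_ ca] <-] e /ev_point ea; apply/ev_point/J_right_ideal.
  apply: omega_eq => e; apply/idP/idP; first exact: sub.
  by apply: sub; exact: unit_orbit_sym.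
have /ev_point/right_idealP [c cx yE] : ev (point_char y) (right_ideal x).
  by rewrite -exy; apply/ev_point/right_ideal_refl.
have /ev_point/right_idealP [d dy xE] : ev (point_char x) (right_ideal y).
  by rewrite exy; apply/ev_point/right_ideal_refl.
have yc : cdom y = cdom c by rewrite yE cdom_mul.
have xd : cdom x = cdom d by rewrite xE cdom_mul.
have cd : cdom c = ctgt d by rewrite dy.
have dc : cdom d = ctgt c by rewrite -xd.
(* x (c d) = x and y (d c) = y, so that c d and d c are identities *)
exists c; last by rewrite yE.
split=> //; exists d; split=> //.
- apply: (@cmulI C x); rewrite ?ctgt_mul ?ctgt_id //.
  by rewrite cmulA // -yE -xE cx cmul1r.
- apply: (@cmulI C y); rewrite ?ctgt_mul ?ctgt_id //.
  by rewrite cmulA // -xE -yE -yc cmul1r.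
Qed.

(** * Units among germs *)

Lemma germ_range_unitP (s : Il C) chi (h : ev chi (j_dom s)) :
  range (@germ_unit C) (germ h) <->
  exists2 e, ev chi e & forall x, \val e x -> graph (\val s) x x.
Proof.
split=> [[psi _] | [e he se]].
  have [e he] := ev_ex psi; rewrite (germ_unitE (ev_il_id he)).
  move=> /germ_eqP [<- [f [hf /pcomp_pidP ef]]].
  exists (j_meet e f); first by rewrite ev_meet he.
  by move=> x [ex fx]; apply/ef.
exists chi => //; rewrite (germ_unitE (ev_il_id he)); apply/germ_eqP.
split=> //; exists e; split=> //; apply/pcomp_pidP => x y ex.
split; first by move=> [_ <-]; exact: se.
by move=> xy; split=> //; apply: graph_fun xy; exact: se.
Qed.

(** A fixed point [z] of [s] suffices because [s], being equivariant, then
fixes the ideal [z C] pointwise. *)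
Lemma germ_point_unit (s : Il C) z (h : ev (point_char z) (j_dom s)) :
  graph (\val s) z z -> range (@germ_unit C) (germ h).
Proof.
move=> zz; apply/germ_range_unitP.
exists (right_ideal z); first exact/ev_point/right_ideal_refl.
move=> _ /right_idealP [c cz ->].
exact: (Il_equivariant (set_valP s) zz).2.
Qed.

(** * Basic open subsets of Omega *)

Definition cylinder (e : J C) (L : seq (J C)) : set (Omega C) :=
  [set chi | ev chi e && ~~ has (ev chi) L].

Lemma cylinder_open e L : open (cylinder e L).
Proof.
elim: L => [|f L IHL].
  rewrite (_ : cylinder e [::] = [set chi | ev chi e]); first exact: ev_open.
  by apply/seteqP; split=> chi; rewrite /cylinder /= andbT.
rewrite (_ : cylinder e (f :: L) =
    cylinder e L `&` (fun psi => ev psi f) @^-1` [set false]).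
  apply: openI => //; apply: open_comp; last exact: discrete_open.
  by move=> ? _; exact: ev_continuous.
apply/seteqP; split=> chi; rewrite /cylinder /= negb_or.
  by move=> /and3P [-> /negbTE -> ->].
by move=> [/andP [-> ->] ->].
Qed.

(** Cylinders are stable under intersection since positive conditions merge
into a meet and negative ones concatenate; so the sets of functions containing
a cylinder around [chi] form a filter, and it converges to [chi] because each
coordinate is decided by some cylinder. *)
Lemma open_cylinder (U : set (Omega C)) chi : open U -> U chi ->
  exists e L, cylinder e L chi /\ cylinder e L `<=` U.
Proof.
move=> [A oA <-] Achi.
pose F : set_system {ptws J C -> bool} := [set B | exists e L,
  cylinder e L chi /\ forall psi, cylinder e L psi -> B (\val psi)].
have FF : Filter F.
  split.
  - by have [e he] := ev_ex chi; exists e, [::]; rewrite /cylinder /= he.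
  - move=> B B' [e [L [/andP [he hL] eB]]] [e' [L' [/andP [he' hL'] eB']]].
    exists (j_meet e e'), (L ++ L'); rewrite /cylinder /=.
    rewrite ev_meet he he' has_cat negb_or hL hL'; split=> // psi.
    rewrite ev_meet has_cat negb_or => /andP[/andP[pe pe'] /andP[pL pL']].
    by split; [apply: eB | apply: eB']; apply/andP.
  - move=> B B' BB' [e [L [he eB]]]; exists e, L; split=> // psi /eB.
    exact: BB'.
have Fchi : F --> (\val chi : {ptws J C -> bool}).
  apply/cvg_sup => f B [_ [[W oW <-] Wchi] WB].
  have [e he] := ev_ex chi.
  case hf : (ev chi f).
    exists f, [::]; rewrite /cylinder /= hf; split=> // psi /andP [pf _].
    by apply: WB; rewrite /= -/(ev psi f) pf -hf.
  exists e, [:: f]; rewrite /cylinder /= he hf; split=> // psi.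
  rewrite orbF => /andP [_ /negbTE pf].
  by apply: WB; rewrite /= -/(ev psi f) pf -hf.
have [|e [L [eL eA]]] := Fchi A; first exact: open_nbhs_nbhs.
by exists e, L.
Qed.

(** Density of the point characters. If no point of [e] avoided the ideals in
[L], then [e] would be the union of its intersections with them, and a
character in Omega cannot be 1 on [e] and 0 on all of these. *)
Lemma cylinder_point e L chi : cylinder e L chi ->
  exists z, cylinder e L (point_char z).
Proof.
move=> /andP [he hL]; apply: contrapT => nz.
pose f (i : 'I_(size L)) := j_meet e (tnth (in_tuple L) i).
have ef : \val e = \bigcup_i \val (f i).
  apply/seteqP; split=> z; last by move=> [i _ []].
  move=> ez; have : has (ev (point_char z)) L.
    apply: contrapT => /negP hz; apply: nz; exists z; apply/andP; split=> //.
    exact/ev_point.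
  move=> /(has_tnthP (t := in_tuple L)) [i /ev_point fz].
  by exists i.
have [_ chiU] := set_valP chi.
have [i] := chiU _ _ _ ef he.
rewrite -/(ev chi (f i)) ev_meet he /= => hi.
by move/negP: hL; apply; apply/(has_tnthP (t := in_tuple L)); exists i.
Qed.

(** * Topological freeness and fixed points of units *)

Definition units_fix_points : Prop :=
  forall (v : cobj C) (u : C), units_at v u ->
  forall (n : nat) (f : 'I_n -> J C),
  (forall i, \val (f i) `<` principal v) ->
  (forall z : C, (principal v `\` \bigcup_i \val (f i)) z ->
     lmul_set z (@invertible C) (cmul u z)) ->
  exists x : C, (principal v `\` \bigcup_i \val (f i)) x /\ cmul u x = x.

(** A right ideal of [v C] containing the identity at [v] is all of [v C]. *)
Lemma proper_ideal_id (e : J C) v : \val e `<` principal v ->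
  ~ \val e (cidm v).
Proof.
move=> [ev_ nve] eid; apply: nve => x; rewrite principalE => /= xv.
by rewrite -[x]cmul1l xv; apply: J_right_ideal; rewrite ?cdom_id.
Qed.

Lemma cylinder_pointP v n (f : 'I_n -> J C) z :
  cylinder (j_principal v) (codom f) (point_char z) <->
  (principal v `\` \bigcup_i \val (f i)) z.
Proof.
split=> [/andP [/ev_point vz /negP fz] | [vz fz]].
  split=> // -[i _ fiz]; apply: fz.
  rewrite has_map; apply/hasP; exists i; rewrite ?mem_enum //.
  exact/ev_point.
apply/andP; split; first exact/ev_point.
rewrite has_map; apply/negP => /hasP [i _ /ev_point fiz].
by apply: fz; exists i.
Qed.

(** The relevant bisection consists of the germs of [u] over the cylinder given
by [v C] and the [f i]; its range map is injective because [u] fixes every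
character of this cylinder. *)
Lemma loop_free_units_fix_points :
  topologically_free (loop_groupoid C) -> units_fix_points.
Proof.
move=> tf v u [uinv ut ud] n f fprop uz; apply: contrapT => nofix.
pose U := cylinder (j_principal v) (codom f).
have dom_u : j_dom (il_lmul u) = j_principal v.
  apply: j_eq => x; rewrite /= principalE -ud; split.
    by move=> [y [+ _]]; rewrite principalE.
  by move=> xu; exists (cmul u x); apply/lmul_graphE.
have hU chi : U chi -> ev chi (j_dom (il_lmul u)).
  by rewrite dom_u => /andP [].
have graph_u z : (principal v `\` \bigcup_i \val (f i)) z ->
    graph (\val (il_lmul u)) z (cmul u z).
  by move=> [+ _]; rewrite principalE /= => zv; apply/lmul_graphE; rewrite ud.
(* a character moved by [u] is moved at some e, and so are those nearby *)
have actU chi (h : ev chi (j_dom (il_lmul u))) : U chi -> act h = chi.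
  move=> Uchi; apply: omega_eq => e; rewrite ev_act; apply: contrapT => ne.
  pose ue := j_conj (il_lmul u) e.
  pose D := U `&` ((fun psi => ev psi ue) @^-1` [set ev chi ue] `&`
    (fun psi => ev psi e) @^-1` [set ev chi e]).
  have oD : open D.
    apply: openI; first exact: cylinder_open.
    by apply: openI; apply: open_comp => [? _|];
      [exact: ev_continuous | exact: discrete_open
      | exact: ev_continuous | exact: discrete_open].
  have [|e' [L [Dchi DL]]] := open_cylinder oD (chi := chi); first by split.
  have [z /DL [Uz [/= z1 z2]]] := cylinder_point Dchi.
  have Xz := (cylinder_pointP _ _ _).1 Uz.
  apply: ne; rewrite -z1 -z2 -(ev_act (hU _ Uz)) (act_point _ (graph_u _ Xz)).
  by have /point_char_eqP <- := uz _ Xz.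
pose gamma : set (loop_groupoid C) := \val @^-1` slice (il_lmul u) U.
have gammaP g : gamma g -> exists chi (h : ev chi (j_dom (il_lmul u))),
    U chi /\ \val g = germ h by [].
have bis : open_bisection (G := loop_groupoid C) gamma.
  split.
  - exists (slice (il_lmul u) U) => //; apply: slice_open.
    exact: cylinder_open.
  - move=> g g' /set_mem/gammaP [chi [h [_ eg]]].
    move=> /set_mem/gammaP [chi' [h' [_ eg']]].
    rewrite /= eg eg' !germ_srcE => e; subst chi'; apply: val_inj.
    by rewrite eg eg'; exact: germ_irr.
  - move=> g g' /set_mem/gammaP [chi [h [Uc eg]]].
    move=> /set_mem/gammaP [chi' [h' [Uc' eg']]].
    rewrite /= eg eg' !germ_rngE !actU // => e; subst chi'; apply: val_inj.
    by rewrite eg eg'; exact: germ_irr.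
have nounit : gamma `<=` ~` range (@gunit (loop_groupoid C)).
  move=> g /gammaP [chi [h [Uchi eg]]] [psi _ epsi].
  have /germ_range_unitP [e he eu] : range (@germ_unit C) (germ h).
    by exists psi => //; rewrite -eg -epsi.
  have [] := @cylinder_point (j_meet (j_principal v) e) (codom f) chi.
    by move/andP: Uchi => [h1 h2]; rewrite /cylinder /= ev_meet h1 he.
  move=> z /andP [/ev_point [vz ez] hz]; apply: nofix; exists z; split.
    by apply/cylinder_pointP/andP; split=> //; exact/ev_point.
  by have /lmul_graphE [_ <-] := eu _ ez.
have Uv : U (point_char (cidm v)).
  apply/cylinder_pointP; split; first by rewrite principalE /= ctgt_id.
  by move=> [i _]; exact: proper_ideal_id.
suff : interior [set x | isotropy (G := loop_groupoid C) x `&` gamma !=set0]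
    (point_char (cidm v)) by rewrite tf.
rewrite /interior; apply: (@filterS _ _ _ U); last first.
  by apply: open_nbhs_nbhs; split=> //; exact: cylinder_open.
move=> chi Uchi; have h := hU _ Uchi.
have lh : loop_germs (germ h).
  by exists u, chi, h; split=> //; split; rewrite ?ut ?ud.
exists (exist _ (germ h) (mem_set lh)); split; last by exists chi, h.
by split; rewrite /= ?germ_srcE ?germ_rngE ?actU.
Qed.

(** Condition III enters only for the unit [u] with [s z = z u] at one
point [z]; translating back along [z] turns its fixed point into one of [s]. *)
Lemma units_fix_points_free :
  units_fix_points -> topologically_free (transformation_groupoid C).
Proof.
move=> sfp gamma [ogamma src_inj _] nounit; apply/seteqP; split=> // chi Vchi.
have [g [[gs gr] gg]] : (isotropy (G := transformation_groupoid C) chi `&`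
  gamma) !=set0 := interior_subset Vchi.
have [s [chi' [h eg]]] := germP g; subst g.
have echi : chi' = chi by rewrite -gs /= germ_srcE.
subst chi'.
have oU := openI (open_interior
  [set x | isotropy (G := transformation_groupoid C) x `&` gamma !=set0])
  (ogamma s).
have [|e [L [eL LU]]] := open_cylinder oU (chi := chi).
  by split=> //; exists h.
have s_fix y : cylinder e L (point_char y) ->
    exists y', [/\ graph (\val s) y y', lmul_set y (@invertible C) y' &
                   y' <> y].
  move=> /LU [/interior_subset [g [[sg rg] Gg]] [k Gk]].
  have /ev_point [y' yy'] := k; exists y'; split=> //.
    (* by injectivity of the source, the isotropy arrow at this
       character is the germ of [s] *)
    have egk : g = germ k.
      by apply: src_inj; rewrite ?inE //= germ_srcE.
    apply/point_char_eqP; rewrite -(act_point k yy') -germ_rngE -egk.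
    exact: esym.
  move=> ey; subst y'; apply: (nounit _ Gk).
  exact: germ_point_unit.
have [z zL] := cylinder_point eL.
(* [s] fixes the character of [z], so [s z] is [z u] for a unit [u] *)
have [zu [szu [u [uinv uz] zuE] _]] := s_fix _ zL; subst zu.
have [ezu szc] := Il_equivariant (set_valP s) szu.
rewrite cdom_mul // in ezu.
move: zL => /andP [/ev_point ez /negP zL].
pose f (i : 'I_(size L)) := j_conj (il_lmul z) (tnth (in_tuple L) i).
have fE i y : ctgt y = cdom z ->
    \val (f i) y <-> \val (tnth (in_tuple L) i) (cmul z y).
  move=> yz; rewrite j_conjP; split.
    by move=> [w /lmul_graphE [_ ->]].
  by move=> fzy; exists (cmul z y) => //; apply/lmul_graphE.
have fprop i : \val (f i) `<` principal (cdom z).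
  split; first by move=> y /j_conjP [w []].
  move=> /(_ (cidm (cdom z))); rewrite principalE /= => vf.
  apply: zL; apply/(has_tnthP (t := in_tuple L)); exists i; apply/ev_point.
  have := vf (ctgt_id _); rewrite -[X in X -> _]/(\val (f i) _).
  by move=> /fE; rewrite ctgt_id cmul1r; apply.
have s_zy y : (principal (cdom z) `\` \bigcup_i \val (f i)) y ->
    [/\ ctgt y = cdom z, cylinder e L (point_char (cmul z y)) &
        graph (\val s) (cmul z y) (cmul z (cmul u y))].
  rewrite principalE => -[/= yz nf]; split=> //; last first.
    by rewrite cmulA; [exact: szc | exact: esym | rewrite yz -ezu].
  apply/andP; split; first by apply/ev_point/J_right_ideal.
  apply/negP => /(has_tnthP (t := in_tuple L)) [i /ev_point fzy].
  by apply: nf; exists i => //; apply/fE.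
have [||x [Xx ux]] := sfp (cdom z) u _ _ f fprop.
- by split.
- move=> y /s_zy [yz /s_fix [w [sw [c [cinv cy] ec] _]] szy].
  rewrite cdom_mul // in cy.
  exists c => //; apply: (@cmulI C z); rewrite ?ctgt_mul // -?ezu //.
  by rewrite cmulA // ec; exact: graph_fun sw szy.
have [xz /s_fix [w [sw _ nw]] szx] := s_zy _ Xx.
by apply: nw; rewrite (graph_fun sw szx) ux.
Qed.

End PointCharacters.

Lemma open_subgroupoid_topologically_free (G : etale_groupoid) (H : set G)
    (Hopen : open H) (Hunit : forall x, H (gunit x))
    (Hmul : forall g h, gsrc g = grng h -> H g -> H h -> H (gmul g h))
    (Hinv : forall g, H g -> H (ginv g)) :
  topologically_free G ->
  topologically_free (open_subgroupoid Hopen Hunit Hmul Hinv).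
Proof.
move=> tf gamma [ogamma si ri] nounit.
pose delta : set G := (\val : H -> G) @` gamma.
have odelta : open delta.
  have [W oW eW] := ogamma.
  rewrite (_ : delta = W `&` H); first exact: openI.
  apply/seteqP; split=> g.
    by move=> [k kg <-]; split; [rewrite -eW in kg | exact: set_valP].
  by move=> [Wg Hg]; exists (exist _ g (mem_set Hg)) => //; rewrite -eW.
have bis : open_bisection delta.
  split=> // _ _ /set_mem [g gg <-] /set_mem [k kg <-] e; congr (\val _).
    by apply: si => //; exact: mem_set.
  by apply: ri => //; exact: mem_set.
have delta_nounit : delta `<=` ~` range (@gunit G).
  move=> _ [g gg <-] [x _ ex]; apply: (nounit _ gg); exists x => //.
  exact: val_inj.
rewrite -(tf _ bis delta_nounit); congr interior.
apply/seteqP; split=> x.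
  by move=> [g [[/= gs gr] gg]]; exists (\val g); split=> //; exists g.
by move=> [k [kx [g gg eg]]]; subst k; exists g.
Qed.

Theorem theorem4p4 (C : left_cancellative_category) :
  let I := topologically_free (transformation_groupoid C) in
  let II := topologically_free (loop_groupoid C) in
  let III :=
    forall (v : cobj C) (u : C), units_at v u ->
    forall (n : nat) (f : 'I_n -> J C),
    (forall i, \val (f i) `<` principal v) ->
    (forall z : C, (principal v `\` \bigcup_i \val (f i)) z ->
       lmul_set z (@invertible C) (cmul u z)) ->
    exists x : C, (principal v `\` \bigcup_i \val (f i)) x /\ cmul u x = x in
  (I <-> II) /\ (II <-> III).
Proof.
move=> I II III.
have I_II : I -> II by exact: open_subgroupoid_topologically_free.
have II_III : II -> III by exact: loop_free_units_fix_points.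
have III_I : III -> I by exact: units_fix_points_free.
by split; split; auto.
Qed.
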